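(* (a) Let $\mu,\nu\in\mathcal{P}_1(\mathbb{R})$. If $e_{1,1}(\mu,\cdot)=e_{1,1}(\nu,\cdot)+C$ on $\mathbb{R}$ for some real constant $C$, then $\mu=\nu$ and $C=0$. (b) If $\mu_n\in\mathcal{P}_1(\mathbb{R})$ for $n\in\mathbb{N}^*\cup\{\infty\}$, the following properties are equivalent: (i) $\mathcal{W}_1(\mu_n,\mu_\infty)\to0$ as $n\to+\infty$; (ii) $e_{1,1}(\mu_n,\cdot)\to e_{1,1}(\mu_\infty,\cdot)$ uniformly on $\mathbb{R}$; (iii) $e_{1,1}(\mu_n,\cdot)\to e_{1,1}(\mu_\infty,\cdot)$ pointwise on $\mathbb{R}$. (c) The distances $\mathcal{Q}_{1,1}$ and $\mathcal{W}_1$ are topologically equivalent on $\mathcal{P}_1(\mathbb{R})$, and $N_{1,1}=1$.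
   Context: $\mathcal{P}_1(\mathbb{R})$ is the set of Borel probability measures on $\mathbb{R}$ with finite first moment; $\mathcal{W}_1$ is the $L^1$-Wasserstein distance. For $\mu\in\mathcal{P}_1(\mathbb{R})$ and $N\ge1$, $e_{N,1}(\mu,(x_1,\dots,x_N))=\int_{\mathbb{R}}\min_{1\le i\le N}|\xi-x_i|\,\mu(d\xi)$; in particular $e_{1,1}(\mu,x)=\int_{\mathbb{R}}|\xi-x|\,\mu(d\xi)$. Set $\mathcal{Q}_{1,1}(\mu,\nu)=\sup_{x\in\mathbb{R}}|e_{1,1}(\mu,x)-e_{1,1}(\nu,x)|$. $N_{1,1}$ is the smallest $N\in\mathbb{N}^*$ such that both: (1) for all $\mu,\nu\in\mathcal{P}_1(\mathbb{R})$, $e_{N,1}(\mu,\cdot)=e_{N,1}(\nu,\cdot)+C$ for some real constant $C$ implies $\mu=\nu$ (and $C=0$); (2) for all $\mu_n$ ($n\ge 1$), $\mu_\infty\in\mathcal{P}_1(\mathbb{R})$, pointwise convergence $e_{N,1}(\mu_n,\cdot)\to e_{N,1}(\mu_\infty,\cdot)$ implies $\mathcal{W}_1(\mu_n,\mu_\infty)\to0$. Two distances are topologically equivalent if they induce the same topology. *)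

(* Defs.v *)
From HB Require Import structures.
From mathcomp Require Import all_boot all_order all_algebra.
From mathcomp Require Import all_classical all_reals all_analysis.

Set Implicit Arguments.
Unset Strict Implicit.
Unset Printing Implicit Defensive.

Import Order.TTheory GRing.Theory Num.Theory numFieldNormedType.Exports.

Local Open Scope classical_set_scope.
Local Open Scope ring_scope.

(* The set P_1(R) of Borel probability measures with finite first moment. *)
Record P1 (R : realType) := MkP1 {
  P1_prob :> probability (measurableTypeR R) R;
  P1_moment : (\int[P1_prob]_xi `|xi|%:E < +oo)%E }.

(* Equality of measures. Leibniz equality would be too strong: a measure of
   the library is a function on all sets, constrained only on measurable
   ones. *)
Definition same_measure (R : realType) (mu nu : P1 R) : Prop :=
  forall A : set (measurableTypeR R), measurable A -> mu A = nu A.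

(* e_{N,1}(mu, x). The minimum is taken in \bar R, so that the neutral element
   +oo does not interfere for N >= 1 (N = 0 is never used); the integral is
   then finite since mu has a finite first moment. *)
Definition quant_err (R : realType) (N : nat) (mu : P1 R) (x : 'I_N -> R) : R :=
  fine (\int[mu]_xi \big[mine/+oo%E]_(i < N) `|xi - x i|%:E)%E.

Definition quant_err1 (R : realType) (mu : P1 R) (x : R) : R :=
  quant_err mu (fun _ : 'I_1 => x).

Lemma quant_err1E (R : realType) (mu : P1 R) (x : R) :
  quant_err1 mu x = fine (\int[mu]_xi `|xi - x|%:E)%E.
Proof.
rewrite /quant_err1 /quant_err; congr fine; apply: eq_integral => xi _.
by rewrite big_ord_recl big_ord0 miney.
Qed.

Definition is_coupling (R : realType) (mu nu : P1 R)
    (pi : probability (measurableTypeR R * measurableTypeR R)%type R) : Prop :=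
  (forall A : set (measurableTypeR R), measurable A ->
     pi (A `*` setT) = mu A) /\
  (forall B : set (measurableTypeR R), measurable B ->
     pi (setT `*` B) = nu B).

Definition W1 (R : realType) (mu nu : P1 R) : \bar R :=
  ereal_inf [set (\int[pi]_z `|z.1 - z.2|%:E)%E | pi in is_coupling mu nu].

Definition Q11 (R : realType) (mu nu : P1 R) : \bar R :=
  ereal_sup (range (fun x : R => `|quant_err1 mu x - quant_err1 nu x|%:E)).

(* Finiteness is part of being a distance, the functions above being a priori
   extended real-valued. *)
Definition is_distance (R : realType) (d : P1 R -> P1 R -> \bar R) : Prop :=
  [/\ forall mu nu, d mu nu \is a fin_num,
      forall mu nu, (0 <= d mu nu)%E,
      forall mu nu, d mu nu = 0%E <-> same_measure mu nu,
      forall mu nu, d mu nu = d nu mu &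
      forall mu nu rho, (d mu rho <= d mu nu + d nu rho)%E].

(* Open sets of the topology induced by d. Such a set is automatically stable
   under same_measure as soon as d is a distance. *)
Definition dist_open (R : realType) (d : P1 R -> P1 R -> \bar R)
    (U : set (P1 R)) : Prop :=
  forall mu, U mu ->
    exists2 eps : R, 0 < eps & forall nu, (d mu nu < eps%:E)%E -> U nu.

Definition topologically_equivalent (R : realType)
    (d1 d2 : P1 R -> P1 R -> \bar R) : Prop :=
  [/\ is_distance d1, is_distance d2 &
      forall U : set (P1 R), dist_open d1 U <-> dist_open d2 U].

Definition static_char (R : realType) (N : nat) : Prop :=
  forall (mu nu : P1 R) (C : R),
    (forall x : 'I_N -> R, quant_err mu x = quant_err nu x + C) ->
    same_measure mu nu /\ C = 0.

Definition convergence_char (R : realType) (N : nat) : Prop :=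
  forall (mu_ : nat -> P1 R) (mu : P1 R),
    (forall x : 'I_N -> R,
       quant_err (mu_ n) x @[n --> \oo] --> quant_err mu x) ->
    W1 (mu_ n) mu @[n --> \oo] --> 0%E.

(* N is the number N_{1,1}: the smallest positive integer with both
   characterization properties. *)
Definition is_N11 (R : realType) (N : nat) : Prop :=
  [/\ (0 < N)%N, static_char R N, convergence_char R N &
      forall M : nat, (0 < M)%N -> static_char R M -> convergence_char R M ->
        (N <= M)%N].

(* Main.v *)
(* For any coupling, Tonelli's theorem turns E|X - Y| into the integral over t
   of P(X <= t < Y) + P(Y <= t < X), which is at least |F(t) - G(t)|, with
   equality for the quantile coupling.  Hence W_1 is the L^1 distance of the
   distribution functions, and e_{1,1}(mu, x) is the L^1 distance from F_mu to
   the distribution function of the Dirac mass at x.  The triangle inequality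
   gives Q_{1,1} <= W_1.  Conversely, e_{1,1}(mu, .) is convex with derivative
   2 F_mu - 1 almost everywhere, so it determines mu up to an additive constant,
   and its pointwise convergence yields that of F_n at the continuity points of
   F; together with the convergence of e_{1,1}(mu_n, 0), Scheffe's lemma
   upgrades this to convergence in L^1, that is, in W_1. *)

Require Import Defs.
From HB Require Import structures.
From mathcomp Require Import all_boot all_order all_algebra.
From mathcomp Require Import all_classical all_reals all_analysis.
From mathcomp Require Import measurable_realfun lra.
Set Implicit Arguments.
Unset Strict Implicit.
Unset Printing Implicit Defensive.
Import Order.TTheory GRing.Theory Num.Theory numFieldNormedType.Exports.
Local Open Scope classical_set_scope.
Local Open Scope ring_scope.

(** * Events separating two random variables at a level *)

Section crossing.
Context d (T : measurableType d) (R : realType) (P : probability T R).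
Implicit Types X Y : T -> R.

(** The symmetric difference of two sublevel sets: the event that the level [t] separates the two
    variables, [X <= t < Y] or [Y <= t < X]. *)
Definition crossing X Y (t : R) : set T :=
  ([set w | X w <= t] `\` [set w | Y w <= t]) `|`
  ([set w | Y w <= t] `\` [set w | X w <= t]).

Let crossing_graph X Y : set (T * R) := [set z | crossing X Y z.2 z.1].

Let measurable_crossing_graph X Y :
  measurable_fun setT X -> measurable_fun setT Y ->
  measurable (crossing_graph X Y).
Proof.
pose L (Z : T -> R) : set (T * R) := [set z | Z z.1 <= z.2].
have mL Z : measurable_fun setT Z -> measurable (L Z).
  move=> mZ; rewrite -[L Z]setTI.
  have mb : measurable_fun setT (fun z : T * R => Z z.1 <= z.2).
    by apply: measurable_fun_ler => //; exact: measurableT_comp.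
  exact: (mb measurableT [set true]).
move=> mX mY; rewrite (_ : crossing_graph X Y = (L X `\` L Y) `|` (L Y `\` L X))//.
by apply: measurableU; apply: measurableD; exact: mL.
Qed.

Let ysection_crossing_graph X Y t :
  ysection (crossing_graph X Y) t = crossing X Y t.
Proof. by apply/seteqP; split => w; rewrite /ysection/= inE. Qed.

Lemma measurable_fun_crossing X Y :
  measurable_fun setT X -> measurable_fun setT Y ->
  measurable_fun setT (fun t => P (crossing X Y t)).
Proof.
move=> mX mY; have := measurable_fun_ysection P (measurable_crossing_graph mX mY).
by apply: eq_measurable_fun => t _ /=; rewrite ysection_crossing_graph.
Qed.

(* By Tonelli: for fixed [w] the set of [t] crossed by the segment from [X w]
   to [Y w] has length [`|X w - Y w|]. *)
Lemma integral_dist_crossing X Y :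
  measurable_fun setT X -> measurable_fun setT Y ->
  (\int[P]_w `|X w - Y w|%:E = \int[lebesgue_measure]_t P (crossing X Y t))%E.
Proof.
move=> mX mY; have mA := measurable_crossing_graph mX mY.
have := @indic_fubini_tonelli _ _ _ _ _ P (@lebesgue_measure R) _ mA.
rewrite indic_fubini_tonelli_FE// indic_fubini_tonelli_GE// => H.
transitivity
    (\int[P]_x (lebesgue_measure \o xsection (crossing_graph X Y)) x)%E; last first.
  by rewrite H; apply: eq_integral => t _ /=; rewrite ysection_crossing_graph.
apply: eq_integral => w _ /=.
(* A level [t] separates [X w] from [Y w] exactly when it is at least their minimum and strictly
   below their maximum. *)
rewrite (_ : xsection _ w = [set` `[Num.min (X w) (Y w), Num.max (X w) (Y w)[%R]).
  rewrite lebesgue_measure_itv/= lte_fin -EFinD minElt maxElt.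
  case: (ltgtP (X w) (Y w)) => [xy|xy|->].
  - by rewrite xy ltr0_norm ?opprB// subr_lt0.
  - by rewrite xy gtr0_norm ?subr_gt0.
  - by rewrite ltxx subrr normr0.
apply/seteqP; split => t; rewrite /xsection /crossing_graph /crossing/= inE/= in_itv/=.
  rewrite ge_min lt_max.
  by case=> -[-> /negP]; rewrite -ltNge => ->; rewrite ?orbT.
case/andP; rewrite ge_min lt_max.
have [|] := leP (X w) t; have [|] := leP (Y w) t => //= Yt Xt _ _.
  by left; split => //; apply/negP; rewrite -ltNge.
by right; split => //; apply/negP; rewrite -ltNge.
Qed.

Lemma measurable_sublevel X (t : R) :
  measurable_fun setT X -> measurable [set w | X w <= t].
Proof.
move=> mX; rewrite (_ : [set w | _] = setT `&` X @^-1` `]-oo, t]%classic).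
  exact: mX.
by rewrite setTI; apply/seteqP; split => w; rewrite /= in_itv.
Qed.

(** Each of two events is contained in the union of the other with their symmetric difference, so
    the latter bounds the gap between their probabilities. *)
Lemma crossing_ge X Y t : measurable_fun setT X -> measurable_fun setT Y ->
  (`|fine (P [set w | (X w <= t)%R]) - fine (P [set w | (Y w <= t)%R])|%:E <=
   P (crossing X Y t))%E.
Proof.
move=> /(measurable_sublevel t) mU /(measurable_sublevel t) mV; rewrite /crossing.
set U := [set w | X w <= t] in mU *; set V := [set w | Y w <= t] in mV *.
have mUV : measurable ((U `\` V) `|` (V `\` U)).
  by apply: measurableU; exact: measurableD.
have sub A B : measurable A -> measurable B ->
    measurable ((A `\` B) `|` (B `\` A)) ->
    (P A <= P ((A `\` B) `|` (B `\` A)) + P B)%E.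
  move=> mA mB mAB; apply: (@le_trans _ _ (P (((A `\` B) `|` (B `\` A)) `|` B))).
    apply: le_measure; rewrite ?inE//; first exact: measurableU.
    by move=> x Ax; have [Bx|nBx] := pselect (B x); [right|left; left].
  exact: measureU2.
have := sub _ _ mU mV mUV; have := sub _ _ mV mU; rewrite setUC => /(_ mUV).
rewrite -[P (_ `|` _)]fineK ?fin_num_measure// -[P U]fineK ?fin_num_measure//.
rewrite -[P V]fineK ?fin_num_measure// -!EFinD !lee_fin /= => h1 h2.
by rewrite ler_norml; apply/andP; split; lra.
Qed.

(** For nested events the symmetric difference is the larger one minus the smaller one, so
    additivity makes [crossing_ge] an equality. *)
Lemma crossing_nested X Y t : measurable_fun setT X -> measurable_fun setT Y ->
  [set w | X w <= t] `<=` [set w | Y w <= t] \/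
  [set w | Y w <= t] `<=` [set w | X w <= t] ->
  P (crossing X Y t) =
  `|fine (P [set w | (X w <= t)%R]) - fine (P [set w | (Y w <= t)%R])|%:E.
Proof.
move=> /(measurable_sublevel t) mU /(measurable_sublevel t) mV; rewrite /crossing.
set U := [set w | X w <= t] in mU *; set V := [set w | Y w <= t] in mV *.
move: U V mU mV => U V mU mV.
wlog UV : U V mU mV / U `<=` V => [hw|_].
  move=> [UV|VU]; first by apply: hw => //; left.
  by rewrite setUC distrC; apply: hw => //; left.
have -> : (U `\` V) `|` (V `\` U) = V `\` U.
  by rewrite (_ : U `\` V = set0) ?set0U// setD_eq0.
have PUV : (fine (P U) <= fine (P V))%R.
  by rewrite fine_le ?fin_num_measure// le_measure ?inE.
rewrite measureD ?setIidr//; last by rewrite -ge0_fin_numE ?fin_num_measure.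
rewrite distrC ger0_norm ?subr_ge0// EFinB.
by congr (_ - _)%E; rewrite fineK// fin_num_measure.
Qed.

End crossing.

(** * Distribution functions of probability measures on the line *)

Section distribution_function.
Variable R : realType.
Implicit Types P Q : probability (measurableTypeR R) R.

Definition distr_fun P (t : R) : R := fine (P `]-oo, t]%classic).

Lemma distr_funE P t : (distr_fun P t)%:E = P `]-oo, t]%classic.
Proof. by rewrite /distr_fun fineK// fin_num_measure. Qed.

Lemma distr_fun_ge0 P t : 0 <= distr_fun P t.
Proof. exact: fine_ge0. Qed.

Lemma distr_fun_le1 P t : distr_fun P t <= 1.
Proof. by rewrite -lee_fin distr_funE probability_le1. Qed.

Lemma nondecreasing_distr_fun P : {homo distr_fun P : s t / s <= t}.
Proof.
move=> s t st; rewrite -lee_fin !distr_funE.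
by apply: le_measure; rewrite ?inE//; apply: subset_itvl.
Qed.

Lemma measurable_distr_fun P : measurable_fun setT (distr_fun P).
Proof. exact: (nondecreasing_measurable measurableT (nondecreasing_distr_fun P)). Qed.

Let idr : measurableTypeR R -> R := idfun.

#[local] HB.instance Definition _ :=
  @isMeasurableFun.Build _ _ _ _ idr (@measurable_id _ _ setT).

Lemma distr_fun_right_continuous P : right_continuous (distr_fun P).
Proof.
move=> a; apply: fine_cvg.
by rewrite distr_funE; exact: (@cdf_right_continuous _ _ _ P idr a).
Qed.

Lemma cvg_distr_fun_pinfty P : distr_fun P t @[t --> +oo] --> (1 : R).
Proof. exact/fine_cvg/(cvg_cdfy1 (idr : {RV P >-> R})). Qed.

Lemma cvg_distr_fun_ninfty P : distr_fun P t @[t --> -oo] --> (0 : R).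
Proof. exact/fine_cvg/(cvg_cdfNy0 (idr : {RV P >-> R})). Qed.

Lemma countable_atoms P : countable [set t | (0 < P [set t])%E].
Proof.
apply: sub_countable (pmf_gt0_countable (idr : {RV P >-> R})).
apply: subset_card_le => t /= t0; rewrite fine_gt0// t0/=.
by rewrite -ge0_fin_numE ?fin_num_measure.
Qed.

(** The open right half-lines generate the Borel sets and are stable under intersection, and the
    mass of each is one minus a value of the distribution function. *)
Lemma probability_eq_distr_fun P Q : distr_fun P =1 distr_fun Q ->
  forall A, measurable A -> P A = Q A.
Proof.
move=> PQ A mA.
apply: (@measure_unique _ R (measurableTypeR R) (@RGenOInfty.G R)
  (fun k => `](- k%:R)%R, +oo[%classic) _ _ _ _ P Q) => //.
- exact: RGenOInfty.measurableE.
- move=> _ _ [x ->] [y ->]; exists (Num.max x y).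
  by apply/seteqP; split => z; rewrite /= !in_itv/= !andbT gt_max => /andP.
- by move=> i; eexists; reflexivity.
- rewrite -subTset => x _ /=; exists (Num.truncn `|x|).+1 => //=.
  rewrite in_itv/= andbT ltrNl.
  by rewrite (le_lt_trans _ (truncnS_gt _))// ler_normr lexx orbT.
- move=> _ [x ->]; suff tail (S : probability (measurableTypeR R) R) :
      S `]x, +oo[%classic = (1 - (distr_fun S x)%:E)%E.
    by rewrite [LHS](tail P) [RHS](tail Q) PQ.
  by rewrite distr_funE -setCitvl probability_setC.
- by move=> k; rewrite (le_lt_trans (probability_le1 _ _)) ?ltry.
Qed.

End distribution_function.

(** * Quantile functions *)

Section quantile.
Variable R : realType.
Implicit Types P Q : probability (measurableTypeR R) R.

(** Outside the open unit interval the set under [inf] may be empty or unbounded below, hence the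
    default value 0. *)
Definition quantile P (u : R) : R :=
  if 0 < u < 1 then inf [set t | u <= distr_fun P t] else 0.

(** The limits of the distribution function at both infinities make the infimum meaningful, and
    right continuity makes it attained; monotonicity then gives the Galois connection. *)
Lemma quantile_le P (u t : R) : 0 < u < 1 ->
  (quantile P u <= t) = (u <= distr_fun P t).
Proof.
move=> u01; rewrite /quantile u01; case/andP: u01 => u0 u1.
set S := [set t | u <= distr_fun P t].
have S0 : S !=set0.
  near (@pinfty_nbhs R) => s; exists s; rewrite /S/= ltW//.
  by near: s; apply: cvgr_gt u1; exact: cvg_distr_fun_pinfty.
have lbS : has_lbound S.
  near (@ninfty_nbhs R) => s; exists s => r; rewrite /S/= => ur.
  rewrite leNgt; apply/negP => rs; move: (ur); rewrite leNgt => /negP; apply.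
  rewrite (le_lt_trans (nondecreasing_distr_fun P (ltW rs)))//.
  by near: s; apply: cvgr_lt u0; exact: cvg_distr_fun_ninfty.
(* Any [s] to the right of the infimum exceeds some element of [S], so [distr_fun P s] is at least
   [u]; let [s] decrease to the infimum. *)
have uS : u <= distr_fun P (inf S).
  apply: (cvgr_to_ge (@distr_fun_right_continuous _ P (inf S))).
  near=> s.
  have [r Sr rs] : exists2 r, S r & r < s.
    by apply: inf_lt => //; near: s; exact: nbhs_right_gt.
  exact: le_trans Sr (nondecreasing_distr_fun P (ltW rs)).
apply/idP/idP => [St|ut]; last exact: ge_inf.
exact: le_trans uS (nondecreasing_distr_fun P St).
Unshelve. all: by end_near. Qed.

Lemma sub_quantile_le P Q (t : R) : distr_fun P t <= distr_fun Q t ->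
  [set u | quantile P u <= t] `<=` [set u | quantile Q u <= t].
Proof.
move=> PQ u /=; have [u01|nu01] := boolP (0 < u < 1).
  by rewrite !quantile_le// => /le_trans; apply.
by rewrite /quantile (negbTE nu01).
Qed.

Lemma measurable_quantile P : measurable_fun setT (quantile P).
Proof.
apply: (measurability _ (RGenOInfty.measurableE R)) => //= _ [_ [x ->] <-].
rewrite setTI -setCitvl preimage_setC; apply: measurableC.
(* The second piece collects the points where the default 0 is taken: all of them count if [0 <= x],
   none otherwise. *)
rewrite [X in measurable X](_ : _ = (`]0, 1[ `&` `]-oo, distr_fun P x]) `|`
  (~` `]0, 1[ `&` [set _ | 0 <= x])).
  apply: measurableU; apply: measurableI => //; first exact: measurableC.
  by case: (0 <= x); rewrite ?set_true ?set_false.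
apply/seteqP; split => u /=; rewrite !in_itv/=.
  have [u01|nu01] := boolP (0 < u < 1); first by rewrite quantile_le//; left.
  by rewrite /quantile (negbTE nu01) => ?; right; split.
by case=> -[/[swap]]; [move=> + u01; rewrite quantile_le|rewrite /quantile => + /negP/negbTE ->].
Qed.

End quantile.

(** * The Wasserstein distance as an L^1 distance of distribution functions *)

Section wasserstein_formula.
Variable R : realType.
Implicit Types P Q : probability (measurableTypeR R) R.

Local Notation leb := (@lebesgue_measure R).
Local Notation unif := (uniform_prob (@ltr01 R)).

Lemma uniform01E (A : set (measurableTypeR R)) : measurable A ->
  unif A = leb (A `&` `[0, 1]%classic).
Proof.
move=> mA; rewrite /uniform_prob integral_uniform_pdf.
rewrite (eq_integral (cst 1%E)); last first.
  move=> u; rewrite inE/= => -[_]; rewrite in_itv/= => u01.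
  by rewrite /uniform_pdf u01 subr0 invr1.
by rewrite integral_cst ?mul1e//; exact: measurableI.
Qed.

(** Within the unit interval the sublevel set is the segment from 0 to [distr_fun P t], up to the
    two endpoints 0 and 1, where the quantile takes its default value; they are Lebesgue-null. *)
Lemma uniform_quantile P (t : R) :
  unif [set u | quantile P u <= t] = (distr_fun P t)%:E.
Proof.
have mA : measurable [set u | quantile P u <= t].
  exact: measurable_sublevel (measurable_quantile P).
have F0 := distr_fun_ge0 P t; have F1 := distr_fun_le1 P t.
rewrite uniform01E//; apply/eqP; rewrite eq_le; apply/andP; split.
  have leb0F : leb `[0, distr_fun P t]%classic = (distr_fun P t)%:E.
    rewrite lebesgue_measure_itv/= lte_fin; case: ltgtP F0 => // [_|<-//] _.
    by rewrite sube0.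
  (* The null singleton of 1 is added to the upper bound because 1 may enter the sublevel set
     through the default value even when [distr_fun P t < 1]. *)
  rewrite -leb0F -[leRHS]adde0 -(lebesgue_measure_set1 1).
  apply: le_trans (measureU2 _ _ _) => //.
  apply: le_measure; rewrite ?inE.
  - exact: measurableI.
  - exact: measurableU.
  move=> u /= [qu]; rewrite !in_itv/= => /andP[u0 u1].
  have [->|n1] := eqVneq u 1; first by right.
  have [->|n0] := eqVneq u 0; first by left; rewrite lexx.
  by left; rewrite u0 -quantile_le// lt_neqAle eq_sym n0 u0 lt_neqAle n1.
have lebo : leb `]0, distr_fun P t[%classic = (distr_fun P t)%:E.
  rewrite lebesgue_measure_itv/= lte_fin; case: ltgtP F0 => // [_|<-//] _.
  by rewrite sube0.
rewrite -lebo; apply: le_measure; rewrite ?inE//; first exact: measurableI.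
move=> u /=; rewrite !in_itv/= => /andP[u0 uF]; split.
  by rewrite quantile_le ?u0 ?(lt_le_trans uF)// ltW.
by rewrite !ltW// (lt_le_trans uF).
Qed.

HB.instance Definition _ P :=
  isMeasurableFun.Build _ _ (measurableTypeR R) (measurableTypeR R)
    (quantile P : measurableTypeR R -> measurableTypeR R) (measurable_quantile P).

Lemma distribution_quantile P (A : set (measurableTypeR R)) : measurable A ->
  unif (quantile P @^-1` A) = P A.
Proof.
pose q : {RV unif >-> measurableTypeR R} :=
  (quantile P : measurableTypeR R -> measurableTypeR R).
apply: (@probability_eq_distr_fun _ (distribution unif q)) => t.
apply: EFin_inj; rewrite -[RHS]uniform_quantile [LHS]distr_funE.
congr (unif _); apply/seteqP; split => u; rewrite /= in_itv.
Qed.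

Definition quantile_coupling P Q (u : measurableTypeR R) :
  measurableTypeR R * measurableTypeR R := (quantile P u, quantile Q u).

Lemma measurable_quantile_coupling P Q :
  measurable_fun setT (quantile_coupling P Q).
Proof. by apply: measurable_fun_pair; exact: measurable_quantile. Qed.

HB.instance Definition _ P Q := isMeasurableFun.Build _ _ _ _
  (quantile_coupling P Q) (measurable_quantile_coupling P Q).

Lemma measurable_fun_absB d (T : measurableType d) (f g : T -> R) :
  measurable_fun setT f -> measurable_fun setT g ->
  measurable_fun setT (fun t => `|f t - g t|%:E).
Proof.
move=> mf mg; apply/measurable_EFinP/measurableT_comp => //.
exact: measurable_funB.
Qed.

Definition L1dist (f g : R -> R) : \bar R := (\int[leb]_t `|f t - g t|%:E)%E.

(* The quantile coupling is optimal because its sublevel sets are nested, so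
   that [crossing_ge] becomes an equality for it. *)
Lemma W1_L1dist (mu nu : P1 R) :
  W1 mu nu = L1dist (distr_fun mu) (distr_fun nu).
Proof.
have mF := measurable_distr_fun mu; have mG := measurable_distr_fun nu.
apply/eqP; rewrite eq_le; apply/andP; split.
  pose Z : {RV unif >-> (measurableTypeR R * measurableTypeR R)%type} :=
    quantile_coupling mu nu.
  apply: ereal_inf_lbound; exists (distribution unif Z).
    by split => A mA; rewrite /distribution /pushforward -[RHS]distribution_quantile//;
      congr (unif _); apply/seteqP; split => u //= [].
  rewrite ge0_integral_distribution//=; last first.
    exact: measurable_fun_absB.
  rewrite integral_dist_crossing; [|exact: measurable_quantile..].
  apply: eq_integral => t _; rewrite crossing_nested; [|exact: measurable_quantile..|].
    transitivity (`|fine (unif [set u | quantile mu u <= t])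
        - fine (unif [set u | quantile nu u <= t])|%:E) => //.
    by rewrite !uniform_quantile.
  by have [/sub_quantile_le|/ltW/sub_quantile_le] :=
    leP (distr_fun mu t) (distr_fun nu t); [left|right].
apply: le_ereal_inf_tmp => _ [pi [pimu pinu] <-].
rewrite integral_dist_crossing//.
apply: ge0_le_integral => //.
- exact: measurable_fun_absB.
- exact: measurable_fun_crossing.
move=> t _.
suff -> : `|distr_fun mu t - distr_fun nu t| =
    `|fine (pi [set z | z.1 <= t]) - fine (pi [set z | z.2 <= t])|.
  exact: crossing_ge.
rewrite /distr_fun -pimu// -pinu//; congr (`|fine (pi _) - fine (pi _)|);
  by apply/seteqP; split => z /=; rewrite in_itv//= => -[].
Qed.

End wasserstein_formula.

(** * The function e_{1,1}: L^1 representation, slopes, injectivity *)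

Section quantization_error.
Variable R : realType.
Implicit Types (mu nu : P1 R) (f g h : R -> R) (x y : R).

Lemma L1dist_ge0 f g : (0 <= L1dist f g)%E.
Proof. by apply: integral_ge0 => t _; rewrite lee_fin. Qed.

Lemma L1distC f g : L1dist f g = L1dist g f.
Proof. by apply: eq_integral => t _; rewrite distrC. Qed.

Lemma L1dist_triangle f g h :
  measurable_fun setT f -> measurable_fun setT g -> measurable_fun setT h ->
  (L1dist f h <= L1dist f g + L1dist g h)%E.
Proof.
move=> mf mg mh; rewrite /L1dist -ge0_integralD//; last 2 first.
- exact: measurable_fun_absB.
- exact: measurable_fun_absB.
apply: ge0_le_integral => //.
- exact: measurable_fun_absB.
- by apply: emeasurable_funD; exact: measurable_fun_absB.
- by move=> t _; rewrite -EFinD lee_fin ler_distD.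
Qed.

(** The distribution function of the Dirac mass at [x]. *)
Definition step x (t : R) : R := (x <= t)%R%:R.

Lemma measurable_step x : measurable_fun setT (step x).
Proof.
apply: (nondecreasing_measurable measurableT) => s t st.
by rewrite /step ler_nat; case: (leP x s) => // /le_trans -> //.
Qed.

(** The constant [x] is treated as a second random variable; its sublevel sets are empty or full,
    hence nested with any other event. *)
Lemma integral_dist_L1dist mu x :
  (\int[mu]_xi `|xi - x|%:E)%E = L1dist (distr_fun mu) (step x).
Proof.
have mi : measurable_fun [set: measurableTypeR R] (@idfun (measurableTypeR R)).
  exact: measurable_id.
rewrite (@integral_dist_crossing _ _ _ mu idfun (cst x))//.
apply: eq_integral => t _; rewrite crossing_nested//; last first.
  rewrite /=; case: (x <= t); first by left.
  by right.
congr (`|_ - _|%:E).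
rewrite /step/=; case: (x <= t).
  by rewrite set_true [mu _]probability_setT.
by rewrite set_false [mu _]measure0.
Qed.

Lemma quant_err1_EFin mu x :
  (quant_err1 mu x)%:E = (\int[mu]_xi `|xi - x|%:E)%E.
Proof.
rewrite quant_err1E fineK// ge0_fin_numE; last exact: integral_ge0.
apply: (@le_lt_trans _ _ (\int[mu]_xi (`|xi|%:E + `|x|%:E))%E).
  apply: ge0_le_integral => //.
  - by apply: measurable_fun_absB.
  - by apply: emeasurable_funD => //; apply/measurable_EFinP; exact: normr_measurable.
  - by move=> t _; rewrite -EFinD lee_fin ler_normB.
rewrite ge0_integralD//; last by apply/measurable_EFinP; exact: normr_measurable.
rewrite integral_cst// lte_add_pinfty ?P1_moment//.
rewrite (_ : (_ * _)%E = `|x|%:E) ?ltry//.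
exact: etrans (congr1 (mule _) (probability_setT mu)) (mule1 _).
Qed.

Lemma quant_err1_L1dist mu x :
  (quant_err1 mu x)%:E = L1dist (distr_fun mu) (step x).
Proof. by rewrite quant_err1_EFin integral_dist_L1dist. Qed.

(** The triangle inequality through [step 0] bounds the distance by the sum of the errors at 0,
    which are finite by the first moment condition. *)
Lemma W1_fin_num mu nu : W1 mu nu \is a fin_num.
Proof.
rewrite W1_L1dist ge0_fin_numE ?L1dist_ge0//.
have := L1dist_triangle (measurable_distr_fun mu) (measurable_step 0)
  (measurable_distr_fun nu).
move/le_lt_trans; apply.
by rewrite (L1distC (step 0)) -!quant_err1_L1dist -EFinD ltry.
Qed.

Lemma quant_err1_le_W1 mu nu x :
  (`|quant_err1 mu x - quant_err1 nu x|%:E <= W1 mu nu)%E.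
Proof.
have mF := measurable_distr_fun mu; have mG := measurable_distr_fun nu.
have mH := measurable_step x.
have := L1dist_triangle mF mG mH; have := L1dist_triangle mG mF mH.
rewrite (L1distC (distr_fun nu) (distr_fun mu)) -W1_L1dist -!quant_err1_L1dist.
rewrite -(fineK (W1_fin_num mu nu)) -!EFinD !lee_fin => h1 h2.
by rewrite ler_norml; apply/andP; split; lra.
Qed.

(** Together with [integral_dist_add_cst], this turns the slope bounds below into pointwise
    comparisons of nonnegative integrands. *)
Lemma integral_dist_add_indic mu x (c z : R) : 0 <= c ->
  (\int[mu]_xi (`|xi - x|%:E + c%:E * (\1_`]-oo, z] xi)%:E))%E =
  (quant_err1 mu x + c * distr_fun mu z)%:E.
Proof.
move=> c0.
have mI : measurable_fun [set: measurableTypeR R]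
    (fun xi => (\1_`]-oo, z] xi : R)%:E).
  by apply/measurable_EFinP; exact: measurable_indic.
rewrite ge0_integralD//; last 3 first.
- exact: measurable_fun_absB.
- by move=> t _; rewrite -EFinM lee_fin mulr_ge0.
- exact: measurable_funeM.
rewrite -quant_err1_EFin ge0_integralZl//.
by rewrite EFinD EFinM distr_funE integral_indic// setIT.
Qed.

Lemma integral_dist_add_cst mu x (c : R) : 0 <= c ->
  (\int[mu]_xi (`|xi - x|%:E + c%:E))%E = (quant_err1 mu x + c)%:E.
Proof.
move=> c0; rewrite ge0_integralD//; last exact: measurable_fun_absB.
rewrite -quant_err1_EFin integral_cst// EFinD; congr (_ + _)%E.
exact: etrans (congr1 (mule _) (probability_setT mu)) (mule1 _).
Qed.

(* [quant_err1 mu] is convex with right derivative [2 * distr_fun mu - 1]. *)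
Lemma quant_err1_slope mu x y : x < y ->
  (2 * distr_fun mu x - 1) * (y - x) <= quant_err1 mu y - quant_err1 mu x
    <= (2 * distr_fun mu y - 1) * (y - x).
Proof.
move=> xy; have yx0 : 0 <= y - x by rewrite subr_ge0 ltW.
have yx20 : 0 <= 2 * (y - x) by rewrite mulr_ge0.
have m1 (z : R) : measurable_fun [set: measurableTypeR R]
    (fun xi => `|xi - z|%:E).
  exact: measurable_fun_absB.
have m2 (z w c : R) : measurable_fun [set: measurableTypeR R]
    (fun xi => `|xi - z|%:E + c%:E * (\1_`]-oo, w] xi)%:E)%E.
  apply: emeasurable_funD => //; apply: measurable_funeM.
  by apply/measurable_EFinP; exact: measurable_indic.
(* The integrands agree when [xi <= x]; when [xi > x] the indicator vanishes and the triangle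
   inequality through [y] suffices. *)
have H1 : quant_err1 mu x + (2 * (y - x)) * distr_fun mu x <=
    quant_err1 mu y + (y - x).
  rewrite -lee_fin -integral_dist_add_indic// -integral_dist_add_cst//.
  apply: ge0_le_integral => //.
  - by move=> xi _; rewrite -EFinM -EFinD lee_fin addr_ge0// mulr_ge0.
  - exact: emeasurable_funD.
  - move=> xi _; rewrite -EFinM -!EFinD lee_fin indicE.
    have [xix|xix] := leP xi x.
      rewrite mem_set/= ?in_itv//= mulr1 !ler0_norm; lra.
    rewrite memNset/=; last by rewrite in_itv/= leNgt xix.
    rewrite mulr0 addr0.
    by rewrite (le_trans (ler_distD y _ _))// lerD2l ger0_norm.
(* Here the integrands agree when [xi > y], and the triangle inequality through [x] handles
   [xi <= y]. *)
have H2 : quant_err1 mu y + (y - x) <=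
    quant_err1 mu x + (2 * (y - x)) * distr_fun mu y.
  rewrite -lee_fin -integral_dist_add_indic// -integral_dist_add_cst//.
  apply: ge0_le_integral => //.
  - by move=> xi _; rewrite -EFinD lee_fin addr_ge0.
  - exact: emeasurable_funD.
  - move=> xi _; rewrite -EFinM -!EFinD lee_fin indicE.
    have [xiy|xiy] := leP xi y.
      rewrite mem_set/= ?in_itv//= mulr1.
      have := ler_distD x xi y; rewrite (distrC x y) (ger0_norm yx0); lra.
    rewrite memNset/=; last by rewrite in_itv/= leNgt xiy.
    rewrite mulr0 addr0 !ger0_norm; lra.
lra.
Qed.

(** The constant cancels in increments, so both measures share the chord slope over [x], [y], which
    lies between [2 * distr_fun mu x - 1] and [2 * distr_fun nu y - 1]. *)
Lemma distr_fun_le_of_slope mu nu (C : R) :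
  (forall x, quant_err1 mu x = quant_err1 nu x + C) ->
  forall x y, x < y -> distr_fun mu x <= distr_fun nu y.
Proof.
move=> munu x y xy.
have /andP[+ _] := quant_err1_slope mu xy; have /andP[_] := quant_err1_slope nu xy.
rewrite !munu => h1 h2.
have : (2 * distr_fun mu x - 1) * (y - x) <= (2 * distr_fun nu y - 1) * (y - x).
  lra.
by rewrite ler_pM2r ?subr_gt0// => ?; lra.
Qed.

Lemma right_continuous_le f g : right_continuous g ->
  (forall x y, x < y -> f x <= g y) -> forall x, f x <= g x.
Proof.
move=> gc fg x; apply: (cvgr_to_ge (gc x)).
by near=> y; apply: fg.
Unshelve. all: by end_near. Qed.

(** Letting [y] decrease to [x] in [distr_fun_le_of_slope], in both directions, identifies the
    distribution functions; once the measures agree, evaluation at 0 gives [C = 0]. *)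
Lemma quant_err1_inj mu nu (C : R) :
  (forall x, quant_err1 mu x = quant_err1 nu x + C) ->
  same_measure mu nu /\ C = 0.
Proof.
move=> munu.
have numu x : quant_err1 nu x = quant_err1 mu x + - C by rewrite munu addrK.
have smn : same_measure mu nu.
  apply: probability_eq_distr_fun => x; apply/eqP; rewrite eq_le.
  apply/andP; split; apply: right_continuous_le;
    by [exact: distr_fun_right_continuous|exact: distr_fun_le_of_slope].
split => //.
have : quant_err1 mu 0 = quant_err1 nu 0.
  by rewrite !quant_err1E; congr fine; apply: eq_measure_integral => A mA _; exact: smn.
by rewrite munu => /eqP; rewrite -subr_eq0 addrAC subrr add0r => /eqP.
Qed.

End quantization_error.

(** * From pointwise convergence of the errors to Wasserstein convergence *)

Section convergence.
Variable R : realType.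

(* Since [`|a - b| + b = a + (`|b - a| + (b - a))] and the last term lies between
   [0] and [2 * b] when [a >= 0], dominated convergence applies to it. *)
Lemma scheffe d (T : measurableType d) (m : {measure set T -> \bar R})
    (f_ : nat -> T -> R) (f : T -> R) :
  (forall n, measurable_fun setT (f_ n)) -> measurable_fun setT f ->
  (forall n x, 0 <= f_ n x) -> (forall x, 0 <= f x) ->
  (\int[m]_x (f x)%:E < +oo)%E ->
  {ae m, forall x, f_ n x @[n --> \oo] --> f x} ->
  (\int[m]_x (f_ n x)%:E @[n --> \oo] --> \int[m]_x (f x)%:E)%E ->
  (\int[m]_x `|f_ n x - f x|%:E @[n --> \oo] --> 0)%E.
Proof.
move=> mf_ mf f_0 f0 foo f_f intf_f.
have fE0 : (0 <= \int[m]_x (f x)%:E)%E by apply: integral_ge0 => x _; rewrite lee_fin.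
have ffin : (\int[m]_x (f x)%:E)%E \is a fin_num by rewrite ge0_fin_numE.
have mfE : measurable_fun setT (EFin \o f) by exact/measurable_EFinP.
have fint : m.-integrable setT (EFin \o f).
  apply/integrableP; split => //.
  by under eq_integral do rewrite gee0_abs ?lee_fin//.
pose g n x := `|f x - f_ n x| + (f x - f_ n x).
have g0 n x : 0 <= g n x by rewrite -[leLHS](subrr `|f x - f_ n x|) lerD2l lerNnormlW.
have mg n : measurable_fun setT (g n).
  apply: measurable_funD; last exact: measurable_funB.
  by apply: measurableT_comp => //; exact: measurable_funB.
have mgE n : measurable_fun setT (EFin \o g n) by exact/measurable_EFinP.
have intg : (\int[m]_x (g n x)%:E @[n --> \oo] --> 0)%E.
  have [] := @dominated_convergence _ T R m setT measurableT
    (fun n => EFin \o g n) (cst 0%E) (fun x => 2%:E * (f x)%:E)%E mgE.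
  - exact: measurable_cst.
  - apply: filterS f_f => x fx _; apply: cvg_EFin; first exact: nearW.
    rewrite (_ : fine \o _ = g ^~ x)//.
    rewrite [X in _ --> X](_ : _ = `|f x - f x| + (f x - f x)); last first.
      by rewrite subrr normr0 addr0.
    have fB : f x - f_ n x @[n --> \oo] --> f x - f x.
      by apply: cvgB => //; exact: cvg_cst.
    by apply: cvgD => //; exact: cvg_norm.
  - exact: integrableZl.
  - apply: aeW => x n _ /=; rewrite lee_fin ger0_norm// /g.
    have := f_0 n x; have := f0 x.
    by have [le|lt] := leP 0 (f x - f_ n x);
      [rewrite ger0_norm//|rewrite ltr0_norm//]; lra.
  by move=> _ _; rewrite integral0.
have key n : (\int[m]_x `|f_ n x - f x|%:E + \int[m]_x (f x)%:E =
    \int[m]_x (f_ n x)%:E + \int[m]_x (g n x)%:E)%E.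
  have mfn : measurable_fun setT (EFin \o f_ n) by exact/measurable_EFinP.
  rewrite -!ge0_integralD//.
  - apply: eq_integral => x _; rewrite -!EFinD /g distrC; congr EFin; lra.
  - by move=> x _; rewrite lee_fin.
  - by move=> x _; rewrite lee_fin.
  - exact: mgE.
  - exact: measurable_fun_absB.
  - by move=> x _; rewrite lee_fin.
have intB n : (\int[m]_x `|f_ n x - f x|%:E =
    \int[m]_x (f_ n x)%:E + \int[m]_x (g n x)%:E - \int[m]_x (f x)%:E)%E.
  by rewrite -key addeK.
under eq_fun do rewrite intB.
(* The limit is put in the shape of the three-term expression of [intB], so that it can be taken
   term by term. *)
have <- : (\int[m]_x (f x)%:E + 0 - \int[m]_x (f x)%:E = 0)%E by rewrite adde0 subee.
apply: cvgeB; [|apply: cvgeD => //|exact: cvg_cst].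
  by rewrite fin_num_adde_defl// fin_numN.
by rewrite fin_num_adde_defl.
Qed.

Implicit Types P : probability (measurableTypeR R) R.

(** Without an atom at [t], the open and closed half-lines ending at [t] have the same mass, and the
    former is an increasing union of closed half-lines. *)
Lemma distr_fun_left_approx P (t eps : R) : P [set t] = 0%E -> 0 < eps ->
  exists2 s, s < t & distr_fun P t - eps < distr_fun P s.
Proof.
move=> Pt0 eps0.
have : P `]-oo, (t - n.+1%:R^-1)%R]%classic @[n --> \oo] --> P `]-oo, t[%classic.
  rewrite (_ : `]-oo, t[%classic =
      \bigcup_n `]-oo, (t - n.+1%:R^-1)%R]%classic); last first.
    apply/seteqP; split => [x|x [n _]]; rewrite /= !in_itv/=.
      move=> /ltr_add_invr[k xk]; exists k => //=.
      by rewrite in_itv/= lerBrDr ltW.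
    by move=> /le_lt_trans; apply; rewrite ltrBlDr ltrDl.
  apply: nondecreasing_cvg_mu => //.
    by apply: bigcup_measurable.
  move=> m n mn; apply/subsetPset; apply: subset_itvl; rewrite bnd_simp.
  by rewrite lerB// lef_pV2 ?posrE// ler_nat.
have -> : P `]-oo, t[%classic = (distr_fun P t)%:E.
  rewrite distr_funE -(@setUitv1 _ _ -oo%O t true)// measureU//; last first.
    by apply/seteqP; split => // x [/=]; rewrite in_itv/= => /[swap] ->; rewrite ltxx.
  exact/esym/(etrans (congr1 (adde _) Pt0))/adde0.
move=> /fine_cvg/cvgr_gt => /(_ (distr_fun P t - eps)).
rewrite ltrBlDr ltrDl => /(_ eps0) h.
near \oo => n; exists (t - n.+1%:R^-1); first by rewrite ltrBlDr ltrDl.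
by near: n.
Unshelve. all: by end_near. Qed.

Section pointwise.
Variables (mu_ : nat -> P1 R) (mu : P1 R).
Hypothesis cvg_err :
  forall x, quant_err1 (mu_ n) x @[n --> \oo] --> quant_err1 mu x.

Let slope_cvg (x y : R) :
  (quant_err1 (mu_ n) y - quant_err1 (mu_ n) x) / (y - x) @[n --> \oo] -->
  (quant_err1 mu y - quant_err1 mu x) / (y - x).
Proof. by apply: cvgMl; exact: cvgB. Qed.

(** Chord slopes converge; those of [mu_ n] are at least [2 * distr_fun (mu_ n) x - 1], and the
    limiting one is at most [2 * distr_fun mu y - 1]. *)
Let distr_fun_near_le (x y eps : R) : x < y -> 0 < eps ->
  \forall n \near \oo, distr_fun (mu_ n) x <= distr_fun mu y + eps.
Proof.
move=> xy eps0.
have /cvgr_lt/(_ ((quant_err1 mu y - quant_err1 mu x) / (y - x) + eps)) :=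
  @slope_cvg x y.
rewrite ltrDl => /(_ eps0); apply: filterS => n.
have /andP[+ _] := quant_err1_slope (mu_ n) xy.
rewrite -ler_pdivlMr ?subr_gt0// => le1.
have /andP[_] := quant_err1_slope mu xy.
rewrite -ler_pdivrMr ?subr_gt0// => le2 lt3; lra.
Qed.

Let distr_fun_near_ge (x y eps : R) : x < y -> 0 < eps ->
  \forall n \near \oo, distr_fun mu x - eps <= distr_fun (mu_ n) y.
Proof.
move=> xy eps0.
have /cvgr_gt/(_ ((quant_err1 mu y - quant_err1 mu x) / (y - x) - eps)) :=
  @slope_cvg x y.
rewrite ltrBlDr ltrDl => /(_ eps0); apply: filterS => n.
have /andP[_] := quant_err1_slope (mu_ n) xy.
rewrite -ler_pdivrMr ?subr_gt0// => le1.
have /andP[+ _] := quant_err1_slope mu xy.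
rewrite -ler_pdivlMr ?subr_gt0// => le2 lt3; lra.
Qed.

(** The value at [t] is squeezed between values of the limit at nearby points [s < t < y]: the
    absence of an atom provides [s], right continuity provides [y]. *)
Lemma cvg_distr_fun (t : R) : mu [set t] = 0%E ->
  distr_fun (mu_ n) t @[n --> \oo] --> distr_fun mu t.
Proof.
move=> mut0; apply/cvgrPdist_le => eps eps0.
have eps20 : 0 < eps / 2 by rewrite divr_gt0.
have [s st Fs] := distr_fun_left_approx mut0 eps20.
have [y ty Fy] : exists2 y, t < y & distr_fun mu y < distr_fun mu t + eps / 2.
  have /cvgr_lt/(_ (distr_fun mu t + eps / 2)) :=
    @distr_fun_right_continuous _ mu t.
  rewrite ltrDl => /(_ eps20) Fy.
  by near t^'+ => y; exists y => //; near: y.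
near=> n; rewrite ler_norml; apply/andP; split.
  suff : distr_fun (mu_ n) t <= distr_fun mu y + eps / 2 by lra.
  by near: n; exact: distr_fun_near_le.
suff : distr_fun mu s - eps / 2 <= distr_fun (mu_ n) t by lra.
by near: n; exact: distr_fun_near_ge.
Unshelve. all: by end_near. Qed.

(* With [H] the distribution function of the Dirac mass at [0], [`|F_n - H|]
   has integral [quant_err1 (mu_ n) 0], and [`|F_n - F|] is the distance of
   [`|F_n - H|] to [`|F - H|], so Scheffe's lemma applies. *)
Lemma cvg_W1 : W1 (mu_ n) mu @[n --> \oo] --> 0%E.
Proof.
pose f (nu : P1 R) (t : R) := `|distr_fun nu t - step 0 t|.
have mf nu : measurable_fun setT (f nu).
  apply: measurableT_comp => //; apply: measurable_funB; first exact: measurable_distr_fun.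
  exact: measurable_step.
have intf nu : (\int[@lebesgue_measure R]_t (f nu t)%:E = (quant_err1 nu 0)%:E)%E.
  by rewrite quant_err1_L1dist.
have W1E n : W1 (mu_ n) mu =
    (\int[@lebesgue_measure R]_t `|f (mu_ n) t - f mu t|%:E)%E.
  rewrite W1_L1dist; apply: eq_integral => t _.
  congr EFin; rewrite /f /step.
  have F0 := distr_fun_ge0 (mu_ n) t; have F1 := distr_fun_le1 (mu_ n) t.
  have G0 := distr_fun_ge0 mu t; have G1 := distr_fun_le1 mu t.
  (* On each side of 0 the difference with [step 0] has a constant sign, as distribution functions
     lie in [0, 1]; the absolute values thus open up and the step cancels. *)
  case: (0 <= t); last by rewrite !subr0 (ger0_norm F0) (ger0_norm G0).
  rewrite (ler0_norm (_ : distr_fun (mu_ n) t - 1 <= 0)) ?subr_le0//.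
  rewrite (ler0_norm (_ : distr_fun mu t - 1 <= 0)) ?subr_le0//.
  by rewrite distrC; congr (`|_|); lra.
under eq_fun do rewrite W1E.
apply: (@scheffe _ (measurableTypeR R) (@lebesgue_measure R)
  (fun n => f (mu_ n)) (f mu)) => //.
- by move=> n; exact: mf.
- exact: mf.
- by move=> n t; exact: normr_ge0.
- by move=> t; exact: normr_ge0.
- by rewrite intf ltry.
(* The exceptional set is the set of atoms of [mu], countable and hence Lebesgue-null. *)
- pose N := [set t | (0 < mu [set t])%E].
  have cN : countable N := countable_atoms mu.
  exists N; split.
  + exact: countable_measurable.
  + exact: countable_lebesgue_measure0.
  move=> t; apply: contra_notP => /= Nt.
  apply: cvg_norm; apply: cvgB; last exact: cvg_cst.
  apply: cvg_distr_fun; apply/eqP; rewrite eq_le measure_ge0 andbT leNgt.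
  exact/negP.
- have : ((quant_err1 (mu_ n) 0)%:E @[n --> \oo] --> (quant_err1 mu 0)%:E)%E.
    by apply: cvg_EFin; [exact: nearW|exact: cvg_err].
  by rewrite -intf; under eq_fun do rewrite -intf.
Qed.

End pointwise.

End convergence.

(** * Metric properties and topological equivalence *)

Section distances.
Variable R : realType.
Implicit Types mu nu rho : P1 R.

Lemma W1_ge0 mu nu : (0 <= W1 mu nu)%E.
Proof. by rewrite W1_L1dist L1dist_ge0. Qed.

Lemma same_measure_quant_err1 mu nu : same_measure mu nu ->
  quant_err1 mu =1 quant_err1 nu.
Proof.
move=> mn x; rewrite !quant_err1E; congr fine.
by apply: eq_measure_integral => A mA _; exact: mn.
Qed.

Lemma W1C mu nu : W1 mu nu = W1 nu mu.
Proof. by rewrite !W1_L1dist L1distC. Qed.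

Lemma W1_triangle mu nu rho : (W1 mu rho <= W1 mu nu + W1 nu rho)%E.
Proof. by rewrite !W1_L1dist; apply: L1dist_triangle; exact: measurable_distr_fun. Qed.

(** A zero distance forces equal error functions by [quant_err1_le_W1], and injectivity applies with
    constant 0. *)
Lemma W1_eq0 mu nu : W1 mu nu = 0%E <-> same_measure mu nu.
Proof.
split=> [W0|mn].
  apply: (proj1 (@quant_err1_inj _ mu nu 0 _)) => x.
  have := quant_err1_le_W1 mu nu x; rewrite W0 lee_fin normr_le0 subr_eq0 addr0.
  by move/eqP.
rewrite W1_L1dist /L1dist integral0_eq// => t _.
by rewrite (_ : distr_fun mu t = distr_fun nu t) ?subrr ?normr0// /distr_fun mn.
Qed.

Lemma W1_is_distance : is_distance (@W1 R).
Proof.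
split; [exact: W1_fin_num|exact: W1_ge0|exact: W1_eq0|exact: W1C|].
exact: W1_triangle.
Qed.

Lemma Q11_ge mu nu x : (`|quant_err1 mu x - quant_err1 nu x|%:E <= Q11 mu nu)%E.
Proof. by apply: ereal_sup_ubound; exists x. Qed.

Lemma Q11_le mu nu (M : \bar R) :
  (forall x, `|quant_err1 mu x - quant_err1 nu x|%:E <= M)%E ->
  (Q11 mu nu <= M)%E.
Proof. by move=> leM; apply: ge_ereal_sup => _ [x _ <-]. Qed.

Lemma Q11_le_W1 mu nu : (Q11 mu nu <= W1 mu nu)%E.
Proof. by apply: Q11_le => x; exact: quant_err1_le_W1. Qed.

Lemma Q11_ge0 mu nu : (0 <= Q11 mu nu)%E.
Proof. by apply: le_trans (Q11_ge mu nu 0); rewrite lee_fin. Qed.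

Lemma Q11_is_distance : is_distance (@Q11 R).
Proof.
split.
- move=> mu nu; rewrite ge0_fin_numE ?Q11_ge0//.
  apply: le_lt_trans (Q11_le_W1 mu nu) _.
  by rewrite -ge0_fin_numE ?W1_ge0// W1_fin_num.
- exact: Q11_ge0.
- move=> mu nu; split=> [Q0|mn].
    apply: (proj1 (@quant_err1_inj _ mu nu 0 _)) => x.
    have := Q11_ge mu nu x; rewrite Q0 lee_fin normr_le0 subr_eq0 addr0.
    by move/eqP.
  apply/eqP; rewrite eq_le Q11_ge0 andbT; apply: Q11_le => x.
  by rewrite (same_measure_quant_err1 mn) subrr normr0.
- by move=> mu nu; rewrite /Q11; congr ereal_sup; apply: eq_imagel => x _; rewrite distrC.
- move=> mu nu rho; apply: Q11_le => x.
  apply: le_trans (leeD (Q11_ge mu nu x) (Q11_ge nu rho x)).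
  by rewrite -EFinD lee_fin ler_distD.
Qed.

Lemma cvg_uniformP (f_ : nat -> R -> R) (f : R -> R) :
  {uniform, f_ @ \oo --> f} <->
  (forall eps, 0 < eps -> \forall n \near \oo, forall x, `|f x - f_ n x| < eps).
Proof.
split=> [ff eps eps0|ff P /uniform_nbhs[E [entE EP]]].
  (* Uniform convergence is tested on the uniform ball of radius [eps] around [f]. *)
  apply: (ff [set h : R -> R | forall x, `|f x - h x| < eps]).
  apply/uniform_nbhs; exists [set z | `|z.1 - z.2| < eps]; split.
    exact: (@entourage_ball _ R (PosNum eps0)).
  by move=> h /= fh x; exact: fh.
move: entE; rewrite -entourage_ballE => -[eps eps0 epsE].
near=> n; apply: EP => x _; apply: epsE; rewrite /= -ball_normE/=.
by move: x; near: n; exact: ff.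
Unshelve. all: by end_near. Qed.

Lemma W1_cvg_uniform (mu_ : nat -> P1 R) mu :
  W1 (mu_ n) mu @[n --> \oo] --> 0%E ->
  {uniform, (fun n => quant_err1 (mu_ n)) @ \oo --> quant_err1 mu}.
Proof.
move=> /fine_cvgP[_ /cvgr_lt W0]; apply/cvg_uniformP => eps eps0.
near=> n => x; rewrite -lte_fin distrC (le_lt_trans (quant_err1_le_W1 _ _ _))//.
rewrite -[W1 _ _]fineK ?W1_fin_num// lte_fin; near: n; exact: W0.
Unshelve. all: by end_near. Qed.

Lemma uniform_cvg_pointwise (f_ : nat -> R -> R) (f : R -> R) :
  {uniform, f_ @ \oo --> f} -> forall x, f_ n x @[n --> \oo] --> f x.
Proof.
move=> /cvg_uniformP ff x; apply/cvgrPdist_lt => eps eps0.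
by apply: filterS (ff _ eps0) => n; exact.
Qed.

(** One inclusion of topologies follows from [Q11_le_W1]. The other is sequential: no modulus
    comparing the two distances is produced, only the convergence theorem [cvg_W1]. *)
Lemma Q11_W1_equivalent : topologically_equivalent (@Q11 R) (@W1 R).
Proof.
split; [exact: Q11_is_distance|exact: W1_is_distance|move=> U; split].
  move=> QU mu /QU[eps eps0 epsU]; exists eps => // nu munu.
  by apply: epsU; exact: le_lt_trans (Q11_le_W1 _ _) munu.
move=> WU mu Umu; have [eps eps0 epsU] := WU _ Umu.
apply: contrapT => noeps.
(* If no [Q11] ball around [mu] fits in [U], radii [1 / (n + 1)] give a sequence outside [U] whose
   errors converge pointwise; by [cvg_W1] it enters the [W1] ball contained in [U]. *)
have /choice[nu_ nuP] : forall n, exists nu,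
    (Q11 mu nu < n.+1%:R^-1%:E)%E /\ ~ U nu.
  move=> n; apply: contrapT => nonu; apply: noeps; exists n.+1%:R^-1 => // nu munu.
  by apply: contrapT => nU; apply: nonu; exists nu.
have : W1 (nu_ n) mu @[n --> \oo] --> 0%E.
  apply: cvg_W1 => x; apply/cvgrPdist_lt => e e0.
  near=> n; rewrite -lte_fin (le_lt_trans (Q11_ge _ _ _))//.
  rewrite (lt_trans (proj1 (nuP n)))// lte_fin.
  by near: n; exact: near_infty_natSinv_lt (PosNum e0).
move=> /fine_cvgP[_ /cvgr_lt /(_ _ eps0)] [n _ /(_ n (leqnn n)) Wn].
apply: (proj2 (nuP n)); apply: epsU; rewrite W1C.
by rewrite -[W1 _ _]fineK ?W1_fin_num// lte_fin.
Unshelve. all: by end_near. Qed.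

Lemma is_N11_1 : is_N11 R 1.
Proof.
split=> // [mu nu C munu|mu_ mu cvg_err].
  apply: quant_err1_inj => x; exact: munu.
by apply: cvg_W1 => x; exact: cvg_err.
Qed.

End distances.

Theorem proposition4p1 (R : realType) :
  (forall (mu nu : P1 R) (C : R),
     (forall x : R, quant_err1 mu x = quant_err1 nu x + C) ->
     same_measure mu nu /\ C = 0)
  /\
  (forall (mu_ : nat -> P1 R) (mu : P1 R),
     (W1 (mu_ n) mu @[n --> \oo] --> 0%E <->
      {uniform, (fun n => quant_err1 (mu_ n)) @ \oo --> quant_err1 mu})
     /\
     ({uniform, (fun n => quant_err1 (mu_ n)) @ \oo --> quant_err1 mu} <->
      (forall x : R, quant_err1 (mu_ n) x @[n --> \oo] --> quant_err1 mu x)))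
  /\
  (topologically_equivalent (@Q11 R) (@W1 R) /\ is_N11 R 1).
Proof.
split; first exact: quant_err1_inj.
split; last by split; [exact: Q11_W1_equivalent|exact: is_N11_1].
move=> mu_ mu; split; split.
- exact: W1_cvg_uniform.
- by move=> /uniform_cvg_pointwise; exact: cvg_W1.
- exact: uniform_cvg_pointwise.
- by move=> /cvg_W1; exact: W1_cvg_uniform.
Qed.
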